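(* Let $(\mathfrak g,[\cdot,\cdots,\cdot]_{\mathfrak g},\alpha)$ be an $n$-Hom-Lie algebra and $D:\wedge^{n-1}\mathfrak g\to\mathfrak g$ a linear map. Let $\mathbb KD$ be the $1$-dimensional vector space generated by $D$ (as a symbol), and on $\mathfrak g\oplus\mathbb KD$ define the totally skew-symmetric $n$-linear bracket $$[x_1+k_1D,\ldots,x_n+k_nD]_D=[x_1,\ldots,x_n]_{\mathfrak g}+\sum_{i=1}^n(-1)^{i-1}k_iD(x_1,\ldots,\widehat{x_i},\ldots,x_n)$$ and the linear map $\alpha_D(x+kD)=\alpha(x)+kD$, for $x,x_i\in\mathfrak g$, $k,k_i\in\mathbb K$. Then $(\mathfrak g\oplus\mathbb KD,[\cdot,\cdots,\cdot]_D,\alpha_D)$ is an $n$-Hom-Lie algebra if and only if $D$ is a generalized derivation on $\mathfrak g$.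
   Context: All vector spaces are over an algebraically closed field $\mathbb K$ of characteristic $0$; $n\ge2$ is an integer. A hat means omission. An $n$-Hom-Lie algebra $(\mathfrak g,[\cdot,\cdots,\cdot]_{\mathfrak g},\alpha)$ is a vector space $\mathfrak g$ with a linear map $[\cdot,\cdots,\cdot]_{\mathfrak g}:\wedge^n\mathfrak g\to\mathfrak g$ and an algebra automorphism $\alpha:\mathfrak g\to\mathfrak g$ (a linear bijection with $\alpha[x_1,\ldots,x_n]_{\mathfrak g}=[\alpha(x_1),\ldots,\alpha(x_n)]_{\mathfrak g}$) such that for all $x_1,\ldots,x_{n-1},y_1,\ldots,y_n\in\mathfrak g$ $$[\alpha(x_1),\ldots,\alpha(x_{n-1}),[y_1,\ldots,y_n]_{\mathfrak g}]_{\mathfrak g}=\sum_{i=1}^n[\alpha(y_1),\ldots,\alpha(y_{i-1}),[x_1,\ldots,x_{n-1},y_i]_{\mathfrak g},\alpha(y_{i+1}),\ldots,\alpha(y_n)]_{\mathfrak g}.$$ Define $\widetilde\alpha(x_1\wedge\cdots\wedge x_{n-1})=\alpha(x_1)\wedge\cdots\wedge\alpha(x_{n-1})$. A linear map $D:\wedge^{n-1}\mathfrak g\to\mathfrak g$ is a generalized derivation if for all $x_i,y_i\in\mathfrak g$: (i) $\alpha\circ D=D\circ\widetilde\alpha$; (ii) $[\alpha(x_1),\ldots,\alpha(x_{n-1}),D(y_1,\ldots,y_{n-1})]_{\mathfrak g}-[\alpha(y_1),\ldots,\alpha(y_{n-1}),D(x_1,\ldots,x_{n-1})]_{\mathfrak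 g}=\sum_{i=1}^{n-1}D(\alpha(y_1),\ldots,\alpha(y_{i-1}),[x_1,\ldots,x_{n-1},y_i]_{\mathfrak g},\alpha(y_{i+1}),\ldots,\alpha(y_{n-1}))$; (iii) $D(\alpha(x_1),\ldots,\alpha(x_{n-2}),[y_1,\ldots,y_n]_{\mathfrak g})=\sum_{i=1}^n[\alpha(y_1),\ldots,\alpha(y_{i-1}),D(x_1,\ldots,x_{n-2},y_i),\alpha(y_{i+1}),\ldots,\alpha(y_n)]_{\mathfrak g}$; (iv) $D(\alpha(x_1),\ldots,\alpha(x_{n-2}),D(y_1,\ldots,y_{n-1}))=\sum_{i=1}^{n-1}D(\alpha(y_1),\ldots,\alpha(y_{i-1}),D(x_1,\ldots,x_{n-2},y_i),\alpha(y_{i+1}),\ldots,\alpha(y_{n-1}))$. *)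

(* Defs.v *)
From HB Require Import structures.
From mathcomp Require Import all_boot all_order all_algebra.
From mathcomp Require Import zify.

Set Implicit Arguments.
Unset Strict Implicit.
Unset Printing Implicit Defensive.

Import GRing.Theory.
Local Open Scope ring_scope.

Section FiniteFamilies.
Variables (m : nat) (T U : Type).

Definition fmapf (f : T -> U) (x : {ffun 'I_m -> T}) : {ffun 'I_m -> U} :=
  [ffun j => f (x j)].

Definition fupd (x : {ffun 'I_m -> T}) (i : 'I_m) (v : T) : {ffun 'I_m -> T} :=
  [ffun j => if j == i then v else x j].

Definition fomit (x : {ffun 'I_m -> T}) (i : 'I_m) : {ffun 'I_m.-1 -> T} :=
  [ffun j => x (lift i j)].

(* For 0 < m, the family (x_1, ..., x_{m-1}, v): [insub] returns [None] exactly
   at the last index of 'I_m. *)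
Definition frcons (x : {ffun 'I_m.-1 -> T}) (v : T) : {ffun 'I_m -> T} :=
  [ffun j : 'I_m => oapp x v (insub (val j))].

End FiniteFamilies.

(* Linear maps from the m-th exterior power of U to V, through the universal
   property: alternating multilinear functions of m arguments in U. An identity
   between such maps is stated on decomposable elements. *)
Record altmap (R : nzRingType) (m : nat) (U V : lmodType R) := AltMap {
  altmap_fun :> {ffun 'I_m -> U} -> V;
  altmap_linear : forall (x : {ffun 'I_m -> U}) (i : 'I_m),
    linear (fun v => altmap_fun (fupd x i v));
  altmap_alt : forall (x : {ffun 'I_m -> U}) (i j : 'I_m),
    i != j -> x i = x j -> altmap_fun x = 0
}.

Section NHomLie.
Variables (K : fieldType) (n : nat) (g : lmodType K).

Record is_n_Hom_Lie (br : altmap n g g) (alpha : {linear g -> g}) : Prop := {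
  nHL_bij : bijective alpha;
  nHL_morph : forall x : {ffun 'I_n -> g},
    alpha (br x) = br (fmapf alpha x);
  nHL_jacobi : forall (x : {ffun 'I_n.-1 -> g}) (y : {ffun 'I_n -> g}),
    br (frcons (fmapf alpha x) (br y)) =
    \sum_(i < n) br (fupd (fmapf alpha y) i (br (frcons x (y i))))
}.

Record generalized_derivation (br : altmap n g g) (alpha : {linear g -> g})
    (D : altmap n.-1 g g) : Prop := {
  gder_comm : forall x : {ffun 'I_n.-1 -> g},
    alpha (D x) = D (fmapf alpha x);
  gder_br_D : forall x y : {ffun 'I_n.-1 -> g},
    br (frcons (fmapf alpha x) (D y)) - br (frcons (fmapf alpha y) (D x)) =
    \sum_(i < n.-1) D (fupd (fmapf alpha y) i (br (frcons x (y i))));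
  gder_D_br : forall (x : {ffun 'I_n.-2 -> g}) (y : {ffun 'I_n -> g}),
    D (frcons (fmapf alpha x) (br y)) =
    \sum_(i < n) br (fupd (fmapf alpha y) i (D (frcons x (y i))));
  gder_D_D : forall (x : {ffun 'I_n.-2 -> g}) (y : {ffun 'I_n.-1 -> g}),
    D (frcons (fmapf alpha x) (D y)) =
    \sum_(i < n.-1) D (fupd (fmapf alpha y) i (D (frcons x (y i))))
}.

End NHomLie.

(* A multilinear function that vanishes when two adjacent arguments are equal is
   alternating. *)
Section AdjacentAlternation.
Variables (R : nzRingType) (m : nat) (U V : lmodType R).
Variable f : {ffun 'I_m -> U} -> V.
Hypothesis f_lin : forall (x : {ffun 'I_m -> U}) (i : 'I_m),
  linear (fun v => f (fupd x i v)).
Hypothesis f_adj : forall (x : {ffun 'I_m -> U}) (i j : 'I_m),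
  j = i.+1 :> nat -> x i = x j -> f x = 0.

Let f_add x i u v : f (fupd x i (u + v)) = f (fupd x i u) + f (fupd x i v).
Proof. by have := f_lin x i 1 u v; rewrite !scale1r. Qed.

Let f_swap (x : {ffun 'I_m -> U}) (i j : 'I_m) : j = i.+1 :> nat ->
  f x = - f (fupd (fupd x i (x j)) j (x i)).
Proof.
move=> ij; have nij : i != j by apply/eqP => e; move: ij; rewrite e; lia.
pose F u v := f (fupd (fupd x i u) j v).
have F0 u : F u u = 0.
  by apply: (f_adj ij); rewrite !ffunE !eqxx (negPf nij).
have FDr u v w : F u (v + w) = F u v + F u w by apply: f_add.
have FC u v : F u v = f (fupd (fupd x j v) i u).
  congr f; apply/ffunP => k; rewrite !ffunE.
  by case: (eqVneq k j) => // ->; rewrite eq_sym (negPf nij).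
have FDl u v w : F (u + v) w = F u w + F v w by rewrite !FC f_add.
have := F0 (x i + x j); rewrite FDl !FDr !F0 add0r addr0 => /eqP.
rewrite addr_eq0 => /eqP <-; congr f; apply/ffunP => k; rewrite !ffunE.
by case: (eqVneq k j) => [->|_] //; case: eqVneq => [->|].
Qed.

Lemma adjacent_alternating (x : {ffun 'I_m -> U}) (i j : 'I_m) :
  i != j -> x i = x j -> f x = 0.
Proof.
wlog ij : i j / (i < j)%N.
  move=> W nij e; have := nij; rewrite -val_eqE /= neq_ltn => /orP[] lt.
    exact: (W i j).
  by apply: (W j i) => //; rewrite eq_sym.
move=> _; have [d dE] : exists d, j = (i + d).+1 :> nat by exists (j - i.+1)%N; lia.
elim: d x j dE {ij} => [|d IH] x j dE xij.
  by apply: f_adj xij; rewrite dE addn0.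
have lt : ((i + d).+1 < m)%N by have := ltn_ord j; lia.
pose k := Ordinal lt.
have kj : j = k.+1 :> nat by rewrite dE /= addnS.
have ik : i != k by apply/eqP => /(congr1 val) /=; lia.
have ij : i != j by apply/eqP => /(congr1 val) /=; lia.
rewrite (f_swap x kj) (IH _ k) ?oppr0 //; rewrite !ffunE.
have kj' : k != j by apply/eqP => /(congr1 val) /=; lia.
by rewrite eqxx (negPf ij) (negPf ik) (negPf kj').
Qed.

End AdjacentAlternation.

Section Extension.
Variables (K : fieldType) (n : nat) (g : lmodType K).

(* The pair (x, k) stands for x + k D. *)
Definition extD : lmodType K := (g * K^o)%type.

Definition alphaD_fun (alpha : g -> g) (u : extD) : extD := (alpha u.1, u.2).

Lemma alphaD_linear (alpha : {linear g -> g}) : linear (alphaD_fun alpha).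
Proof. by move=> a u v; rewrite /alphaD_fun /= linearP. Qed.

HB.instance Definition _ (alpha : {linear g -> g}) :=
  GRing.isLinear.Build K extD extD *:%R (alphaD_fun alpha) (alphaD_linear alpha).

Definition alphaD (alpha : {linear g -> g}) : {linear extD -> extD} :=
  alphaD_fun alpha.

Variables (br : altmap n g g) (D : altmap n.-1 g g).

(* Indices start at 0 here, so that the sign (-1)^(i-1) becomes (-1)^i. *)
Definition brD_fun (u : {ffun 'I_n -> extD}) : extD :=
  (br (fmapf fst u) +
     \sum_(i < n) (-1) ^+ i *: ((u i).2 *: D (fomit (fmapf fst u) i)),
   0).

Lemma brD_linear (u : {ffun 'I_n -> extD}) (p : 'I_n) :
  linear (fun v => brD_fun (fupd u p v)).
Proof.
move=> a v w; rewrite /brD_fun; congr pair; last by rewrite /= scaler0 addr0.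
have E z : fmapf fst (fupd u p z) = fupd (fmapf fst u) p z.1.
  by apply/ffunP => j; rewrite !ffunE; case: ifP.
rewrite /= !E /= (altmap_linear br) scalerDr -!addrA; congr (_ + _).
rewrite [in RHS]addrCA; congr (_ + _).
rewrite scaler_sumr -big_split; apply: eq_bigr => i _ /=.
rewrite [a *: (_ *: _)]scalerA [a * _]mulrC -scalerA -scalerDr; congr (_ *: _).
rewrite !ffunE; case: (eqVneq i p) => [->|nip].
  have O z : fomit (fupd (fmapf fst u) p z) p = fomit (fmapf fst u) p.
    by apply/ffunP => j; rewrite !ffunE eq_sym (negPf (neq_lift _ _)).
  by rewrite !O /= scalerDl scalerA.
have [q qE _] := unlift_some nip.
have O z : fomit (fupd (fmapf fst u) p z) i = fupd (fomit (fmapf fst u) i) q z.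
  by apply/ffunP => j; rewrite !ffunE qE (inj_eq lift_inj).
by rewrite !O (altmap_linear D) scalerDr !scalerA mulrC.
Qed.

Lemma brD_adj (u : {ffun 'I_n -> extD}) (i j : 'I_n) :
  j = i.+1 :> nat -> u i = u j -> brD_fun u = 0.
Proof.
move=> ij uij; have nij : i != j by apply/eqP => e; move: ij; rewrite e; lia.
have fij : fmapf fst u i = fmapf fst u j by rewrite !ffunE uij.
rewrite /brD_fun (altmap_alt br nij fij) add0r; congr pair.
rewrite (bigD1 i) //= (bigD1 j) 1?eq_sym //= big1 => [|k /andP[ki kj]].
  rewrite addr0 uij ij exprS mulN1r scaleNr.
  have -> : fomit (fmapf fst u) j = fomit (fmapf fst u) i.
    apply/ffunP => l; rewrite ![fomit _ _ _]ffunE.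
    have [li|li] := eqVneq (nat_of_ord l) (nat_of_ord i).
      have -> : lift j l = i by apply/val_inj; rewrite /= /bump ij li ltnn.
      have -> : lift i l = j by apply/val_inj; rewrite /= /bump li leqnn ij.
      by rewrite !ffunE uij.
    congr (fmapf _ _ _); apply/val_inj; rewrite /= /bump ij.
    by rewrite [in RHS]leq_eqVlt eq_sym (negPf li).
  by rewrite subrr.
have [p pE _] := unlift_some ki; have [q qE _] := unlift_some kj.
rewrite (@altmap_alt _ _ _ _ D _ p q) ?scaler0 //.
  by apply: contraNneq nij => pq; rewrite pE qE pq.
by rewrite ![fomit _ _ _]ffunE -pE -qE.
Qed.

Definition brD : altmap n extD extD :=
  AltMap brD_linear (adjacent_alternating brD_linear brD_adj).

End Extension.

(* Main.v *)
(** An alternating multilinear map on g + K D is determined by its values on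
    families taken from g and on families from g followed by the symbol D:
    subtracting multiples of one argument with a D-component from the others
    leaves at most one argument outside g, and a transposition moves it to the
    end. Both sides of the Hom-Jacobi identity are alternating multilinear
    separately in (x_1, ..., x_{n-1}) and in (y_1, ..., y_n), so the identity on
    g + K D amounts to four cases: without D it is the identity of g, with D
    among the y only it is condition (ii), among the x only it is (iii), and
    among both it is (iv). In the same way, multiplicativity of the twist map
    amounts to condition (i). *)
Require Import Defs.
From HB Require Import structures.
From mathcomp Require Import all_boot all_order all_algebra.

Set Implicit Arguments.
Unset Strict Implicit.
Unset Printing Implicit Defensive.

Import GRing.Theory.
Local Open Scope ring_scope.

(** * Finite families: appending a last entry and replacing a single entry *)

Lemma ffun_lift_maxP (m : nat) (T : Type) (z z' : {ffun 'I_m.+1 -> T}) :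
    (forall j, z (lift ord_max j) = z' (lift ord_max j)) ->
  z ord_max = z' ord_max -> z = z'.
Proof.
move=> eqj eqm; apply/ffunP => k.
by case: (unliftP ord_max k) => [j|] ->.
Qed.

Lemma frcons_max (m : nat) (T : Type) (x : {ffun 'I_m -> T}) v :
  frcons (m := m.+1) x v ord_max = v.
Proof. by rewrite ffunE insubF //= ltnn. Qed.

Lemma frcons_lift (m : nat) (T : Type) (x : {ffun 'I_m -> T}) v (j : 'I_m) :
  frcons (m := m.+1) x v (lift ord_max j) = x j.
Proof.
rewrite ffunE (_ : val _ = val j) ?valK //.
by rewrite /= /bump leqNgt ltn_ord.
Qed.

Section FiniteFamilyTheory.
Variables (m : nat) (T U : Type).
Implicit Types (x : {ffun 'I_m -> T}) (v w : T).

Lemma fupd_frcons_max x v w :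
  fupd (frcons (m := m.+1) x v) ord_max w = frcons (m := m.+1) x w.
Proof.
apply: ffun_lift_maxP => [j|]; last by rewrite ffunE eqxx frcons_max.
by rewrite ffunE eq_sym (negPf (neq_lift _ _)) !frcons_lift.
Qed.

Lemma fupd_frcons_lift x v w (i : 'I_m) :
  fupd (frcons (m := m.+1) x v) (lift ord_max i) w =
  frcons (m := m.+1) (fupd x i w) v.
Proof.
apply: ffun_lift_maxP => [j|].
  by rewrite ffunE !frcons_lift ffunE (inj_eq lift_inj).
by rewrite ffunE (negPf (neq_lift _ _)) !frcons_max.
Qed.

Lemma fomit_frcons_max x v : fomit (frcons (m := m.+1) x v) ord_max = x.
Proof. by apply/ffunP => j; rewrite ffunE frcons_lift. Qed.

Lemma fmapf_frcons (f : T -> U) x v :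
  fmapf f (frcons (m := m.+1) x v) = frcons (m := m.+1) (fmapf f x) (f v).
Proof.
apply: ffun_lift_maxP => [j|]; rewrite [LHS]ffunE; last by rewrite !frcons_max.
by rewrite !frcons_lift ffunE.
Qed.

Lemma fmapf_fupd (f : T -> U) x i v :
  fmapf f (fupd x i v) = fupd (fmapf f x) i (f v).
Proof. by apply/ffunP => j; rewrite !ffunE; case: ifP. Qed.

Lemma fupd_id x i : fupd x i (x i) = x.
Proof. by apply/ffunP => j; rewrite ffunE; case: eqP => [->|]. Qed.

Lemma fupd_same x i v w : fupd (fupd x i v) i w = fupd x i w.
Proof. by apply/ffunP => j; rewrite !ffunE; case: eqP. Qed.

Lemma fupdC x i j v w :
  i != j -> fupd (fupd x i v) j w = fupd (fupd x j w) i v.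
Proof.
move=> nij; apply/ffunP => k; rewrite !ffunE.
by case: (eqVneq k j) => // ->; rewrite eq_sym (negPf nij).
Qed.

End FiniteFamilyTheory.

Lemma sum_ord_max (m : nat) (V : nmodType) (F : 'I_m.+1 -> V) :
  \sum_i F i = F ord_max + \sum_i F (lift ord_max i).
Proof. exact: bigD1_ord. Qed.

(** * Elementary identities for alternating maps *)

Section AltmapTheory.
Variables (R : nzRingType) (m : nat) (U V : lmodType R) (f : altmap m U V).

Definition altmap_arg (x : {ffun 'I_m -> U}) (i : 'I_m) (v : U) : V :=
  f (fupd x i v).

HB.instance Definition _ x i :=
  GRing.isLinear.Build R U V *:%R (altmap_arg x i) (altmap_linear f x i).

Lemma altmap_add x i v w :
  f (fupd x i (v + w)) = f (fupd x i v) + f (fupd x i w).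
Proof. exact: (linearD (altmap_arg x i)). Qed.

Lemma altmap_scale x i a v : f (fupd x i (a *: v)) = a *: f (fupd x i v).
Proof. exact: (linearZ_LR (altmap_arg x i)). Qed.

Lemma altmap_fupd_eq x i j : i != j -> f (fupd x i (x j)) = 0.
Proof.
move=> nij; apply: (altmap_alt f nij).
by rewrite !ffunE eqxx eq_sym (negPf nij).
Qed.

(** By linearity in place [i], the added term has equal entries at [i] and [j] and vanishes. This is
    the elimination step that clears components along [symD]. *)
Lemma altmap_add_mul x i j a :
  i != j -> f (fupd x i (x i + a *: x j)) = f x.
Proof.
move=> nij; rewrite altmap_add altmap_scale (altmap_fupd_eq _ nij) fupd_id.
by rewrite scaler0 addr0.
Qed.

(** Polarization: expand the vanishing value with [v + w] in both places. *)
Lemma altmap_swap x i j v w :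
  i != j -> f (fupd (fupd x i v) j w) = - f (fupd (fupd x i w) j v).
Proof.
move=> nij; have f0 u : f (fupd (fupd x i u) j u) = 0.
  by apply: (altmap_alt f nij); rewrite !ffunE !eqxx (negPf nij).
have := f0 (v + w); rewrite altmap_add !(fupdC _ _ _ nij) !altmap_add.
rewrite -!(fupdC _ _ _ nij) !f0 add0r addr0 => /eqP.
by rewrite addrC addr_eq0 => /eqP.
Qed.

End AltmapTheory.

(** * The last argument of an alternating map *)

Section AltmapRcons.
Variables (R : nzRingType) (m : nat) (U V : lmodType R) (f : altmap m.+1 U V).

Lemma altmap_rcons_linear (x : {ffun 'I_m -> U}) :
  linear (fun v => f (frcons (m := m.+1) x v)).
Proof.
have E u : f (frcons (m := m.+1) x u) =
    altmap_arg f (frcons (m := m.+1) x 0) ord_max u.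
  by rewrite /altmap_arg fupd_frcons_max.
by move=> a v w; rewrite !E linearP.
Qed.

Lemma altmap_rcons_scale (x : {ffun 'I_m -> U}) a v :
  f (frcons (m := m.+1) x (a *: v)) = a *: f (frcons (m := m.+1) x v).
Proof. by rewrite -(fupd_frcons_max x 0) altmap_scale fupd_frcons_max. Qed.

Lemma altmap_rcons0 (x : {ffun 'I_m -> U}) : f (frcons (m := m.+1) x 0) = 0.
Proof.
by rewrite -[X in frcons _ X](scale0r (0 : U)) altmap_rcons_scale scale0r.
Qed.

Lemma altmap_contract_linear w (x : {ffun 'I_m -> U}) i :
  linear (fun v => f (frcons (m := m.+1) (fupd x i v) w)).
Proof. by move=> a u v; rewrite -!fupd_frcons_lift (altmap_linear f). Qed.

Lemma altmap_contract_alt w (x : {ffun 'I_m -> U}) i j :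
  i != j -> x i = x j -> f (frcons (m := m.+1) x w) = 0.
Proof.
move=> nij xij; apply: (@altmap_alt _ _ _ _ f _ (lift ord_max i) (lift ord_max j)).
  by rewrite (inj_eq lift_inj).
by rewrite !frcons_lift.
Qed.

(** Up to sign the interior product with [w]. It exhibits the bracket as an alternating map of its
    first arguments once the last one is fixed. *)
Definition altmap_contract w : altmap m U V :=
  AltMap (altmap_contract_linear w) (@altmap_contract_alt w).

End AltmapRcons.

(** This serves to bring [symD] from the last but one place to the last, where the value of the
    extended bracket is known. *)
Lemma altmap_rcons2_swap (R : nzRingType) (m : nat) (U V : lmodType R)
    (f : altmap m.+2 U V) (x : {ffun 'I_m -> U}) v w :
  f (frcons (m := m.+2) (frcons (m := m.+1) x v) w) =
  - f (frcons (m := m.+2) (frcons (m := m.+1) x w) v).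
Proof.
have E a b : frcons (m := m.+2) (frcons (m := m.+1) x a) b =
    fupd (fupd (frcons (m := m.+2) (frcons (m := m.+1) x 0) 0)
               (lift ord_max ord_max) a) ord_max b.
  by rewrite fupd_frcons_lift !fupd_frcons_max.
rewrite (E v w) altmap_swap; first by rewrite -(E w v).
by rewrite eq_sym neq_lift.
Qed.

(** * Alternating maps built from others: composites, sums, twisted derivations *)

Section AltmapConstructions.
Variables (R : nzRingType) (m : nat) (U V W : lmodType R).

Section Composition.
Variables (h : {linear V -> W}) (a : {linear U -> U}) (f : altmap m U V).

Lemma altmap_comp_linear (x : {ffun 'I_m -> U}) i :
  linear (fun v => h (f (fmapf a (fupd x i v)))).
Proof. by move=> c u v; rewrite !fmapf_fupd linearP (altmap_linear f) linearP. Qed.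

Lemma altmap_comp_alt (x : {ffun 'I_m -> U}) i j :
  i != j -> x i = x j -> h (f (fmapf a x)) = 0.
Proof.
move=> nij xij; rewrite (altmap_alt f nij) ?linear0 //.
by rewrite !ffunE xij.
Qed.

Definition altmap_comp : altmap m U W :=
  AltMap altmap_comp_linear altmap_comp_alt.

End Composition.

Section Sum.
Variables (p : nat) (F : 'I_p -> altmap m U V).

Lemma altmap_sum_linear (x : {ffun 'I_m -> U}) i :
  linear (fun v => \sum_k F k (fupd x i v)).
Proof.
move=> c u v; rewrite scaler_sumr -big_split.
by apply: eq_bigr => k _; rewrite /= (altmap_linear (F k)).
Qed.

Lemma altmap_sum_alt (x : {ffun 'I_m -> U}) i j :
  i != j -> x i = x j -> \sum_k F k x = 0.
Proof. by move=> nij xij; rewrite big1 // => k _; apply: altmap_alt nij xij. Qed.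

Definition altmap_sum : altmap m U V := AltMap altmap_sum_linear altmap_sum_alt.

End Sum.

Section Derivation.
Variables (f : altmap m U V) (a b : {linear U -> U}).

(** With [f] the bracket, [a] the twist map and [b] the bracket with fixed first arguments, this is
    the right side of the Hom-Jacobi identity as a function of y. *)
Let der (x : {ffun 'I_m -> U}) := \sum_k f (fupd (fmapf a x) k (b (x k))).

Lemma altmap_der_linear (x : {ffun 'I_m -> U}) i :
  linear (fun v => der (fupd x i v)).
Proof.
move=> c u v; rewrite scaler_sumr -big_split; apply: eq_bigr => k _ /=.
rewrite !fmapf_fupd; have [->|nki] := eqVneq k i.
  by rewrite !fupd_same !ffunE eqxx linearP (altmap_linear f).
rewrite !ffunE (negPf nki) !(@fupdC _ _ _ i k) 1?eq_sym //.
by rewrite linearP (altmap_linear f).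
Qed.

(** The summands other than [i] and [j] still have two equal arguments and vanish; the summands [i]
    and [j] differ by a transposition and cancel. *)
Lemma altmap_der_alt (x : {ffun 'I_m -> U}) i j :
  i != j -> x i = x j -> der x = 0.
Proof.
move=> nij xij; have axij : fmapf a x i = fmapf a x j by rewrite !ffunE xij.
rewrite /der (bigD1 i) //= (bigD1 j) 1?eq_sym //= big1 => [|k /andP[ki kj]].
  rewrite addr0 xij -{1}(fupd_id (fmapf a x) j) -(fupdC _ _ _ nij).
  by rewrite altmap_swap // -axij fupd_id addNr.
apply: (altmap_alt f nij).
by rewrite !ffunE !(eq_sym _ k) (negPf ki) (negPf kj) xij.
Qed.

Definition altmap_der : altmap m U V := AltMap altmap_der_linear altmap_der_alt.

End Derivation.
End AltmapConstructions.

(** * The space g + K D and the reduction to special families *)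

Section ExtensionTheory.
Variables (K : fieldType) (g : lmodType K).

Definition in_ext (x : g) : extD g := (x, 0).
Definition symD : extD g := (0, 1).

Lemma in_ext_linear : linear in_ext.
Proof. by move=> a x y; congr pair; rewrite /= scaler0 addr0. Qed.

HB.instance Definition _ :=
  GRing.isLinear.Build K g (extD g) *:%R in_ext in_ext_linear.

Lemma in_ext_inj : injective in_ext.
Proof. by move=> x y []. Qed.

Lemma extD_decomp (u : extD g) : u = in_ext u.1 + u.2 *: symD.
Proof.
case: u => x k; congr pair => /=; first by rewrite scaler0 addr0.
by rewrite add0r; apply/esym/mulr1.
Qed.

Lemma fmapf_in_ext (m : nat) (u : {ffun 'I_m -> extD g}) :
  (forall j, (u j).2 = 0) -> u = fmapf in_ext (fmapf fst u).
Proof.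
by move=> u0; apply/ffunP => j; rewrite !ffunE {1}[u j]surjective_pairing u0.
Qed.

Lemma altmap_extD_eq (m : nat) (V : lmodType K) (F G : altmap m.+1 (extD g) V) :
    (forall x, F (fmapf in_ext x) = G (fmapf in_ext x)) ->
    (forall x, F (frcons (m := m.+1) (fmapf in_ext x) symD) =
               G (frcons (m := m.+1) (fmapf in_ext x) symD)) ->
  forall u, F u = G u.
Proof.
move=> FG0 FG1 u.
pose family := {ffun 'I_m.+1 -> extD g}.
have FGpure (w : family) : (forall j, (w j).2 = 0) -> F w = G w.
  by move=> /fmapf_in_ext->.
have FGmax (w : family) : (forall j, (w (lift ord_max j)).2 = 0) ->
    F (fupd w ord_max symD) = G (fupd w ord_max symD).
  move=> w0; pose x := [ffun j => (w (lift ord_max j)).1].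
  suff -> : fupd w ord_max symD = frcons (m := m.+1) (fmapf in_ext x) symD by [].
  apply: ffun_lift_maxP => [j|]; last by rewrite frcons_max ffunE eqxx.
  rewrite frcons_lift !ffunE eq_sym (negPf (neq_lift _ _)).
  by rewrite [LHS]surjective_pairing w0.
have FGD (w : family) p : (forall j, j != p -> (w j).2 = 0) ->
    F (fupd w p symD) = G (fupd w p symD).
  have [->|npm] := eqVneq p ord_max => w0.
    by apply: FGmax => j; rewrite w0 // eq_sym neq_lift.
  (* Writing the last entry as an update makes the transposition of [p] with the last place
     applicable; the sign is the same for [F] and [G]. *)
  rewrite -(fupd_id (fupd w p symD) ord_max).
  rewrite (altmap_swap F _ _ _ npm) (altmap_swap G _ _ _ npm).
  congr (- _); apply: FGmax => j; rewrite !ffunE [ord_max == p]eq_sym (negPf npm).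
  by case: ifP => [_|/negbT jp]; rewrite w0 // eq_sym.
(* Induction on the number of arguments with nonzero D-component. *)
have [c] := ubnP #|[set j | (u j).2 != 0]|.
elim: c u => // c IH u; rewrite ltnS => le_c.
have [/existsP[p p0]|/existsPn u0] := boolP [exists p, (u p).2 != 0]; last first.
  by apply: FGpure => j; apply/eqP; rewrite -[_ == _]negbK u0.
have [/existsP[q /andP[nqp q0]]|/existsPn u0] :=
    boolP [exists q, (q != p) && ((u q).2 != 0)]; last first.
  (* Only [u p] lies outside g: split it into its g-part and a multiple of [symD]. *)
  have u0' j : j != p -> (u j).2 = 0.
    by move=> jp; apply/eqP; move: (u0 j); rewrite jp /= negbK.
  rewrite -(fupd_id u p) [u p]extD_decomp !altmap_add !altmap_scale.
  rewrite FGD // FGpure // => j; rewrite ffunE.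
  by case: (eqVneq j p) => // /u0'.
(* With [u p] as pivot, this multiple cancels the D-component of [u q] and changes no other
   argument. *)
pose a := - ((u q).2 / (u p).2).
rewrite -(altmap_add_mul F u a nqp) -(altmap_add_mul G u a nqp).
apply: IH; apply: leq_trans le_c; apply: proper_card.
have uq0 : (u q + a *: u p).2 = 0.
  by rewrite /= /a scaleNr [_ *: _]mulfVK // subrr.
apply/properP; split; last by exists q; rewrite !inE // ffunE eqxx uq0 eqxx.
by apply/subsetP => j; rewrite !inE ffunE; case: (eqVneq j q) => [->|].
Qed.

End ExtensionTheory.

(** * Values of the extended bracket, and multiplicativity of the extended twist map *)

Section Bracket.
Variables (K : fieldType) (m : nat) (g : lmodType K).
Variables (br : altmap m.+1 g g) (D : altmap m g g) (alpha : {linear g -> g}).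
Let B := brD (n := m.+1) br D.
Let A := alphaD alpha.

Lemma brD_in_ext (x : {ffun 'I_m.+1 -> g}) :
  B (fmapf (@in_ext K g) x) = in_ext (br x).
Proof.
rewrite /B /= /brD_fun big1 ?addr0 => [|i _]; last first.
  by rewrite ffunE scale0r scaler0.
by congr (in_ext (br _)); apply/ffunP => j; rewrite !ffunE.
Qed.

(** Only the last summand has a nonzero coefficient, and its index, counted from 0, is [m]; the term
    in [br] vanishes because [symD] has g-component 0. *)
Lemma brD_rcons_symD (x : {ffun 'I_m -> g}) :
  B (frcons (m := m.+1) (fmapf (@in_ext K g) x) (symD g)) =
  in_ext ((-1) ^+ m *: D x).
Proof.
rewrite /B /= /brD_fun; congr pair; rewrite fmapf_frcons.
rewrite (bigD1 ord_max) //= big1 => [|i]; last first.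
  case: (unliftP ord_max i) => [j|] ->; last by rewrite eqxx.
  by rewrite frcons_lift ffunE scale0r scaler0.
rewrite frcons_max scale1r fomit_frcons_max addr0.
have -> : fmapf fst (fmapf (@in_ext K g) x) = x.
  by apply/ffunP => j; rewrite !ffunE.
by rewrite altmap_rcons0 add0r.
Qed.

Lemma alphaD_in_ext (p : nat) (x : {ffun 'I_p -> g}) :
  fmapf A (fmapf (@in_ext K g) x) = fmapf (@in_ext K g) (fmapf alpha x).
Proof. by apply/ffunP => j; rewrite !ffunE. Qed.

Lemma alphaD_symD : A (symD g) = symD g.
Proof. by rewrite /A /= /alphaD_fun linear0. Qed.

Lemma alphaD_bij : bijective alpha -> bijective A.
Proof.
case=> beta alphaK betaK; exists (fun u => (beta u.1, u.2)) => -[x k].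
  by rewrite /A /= /alphaD_fun alphaK.
by rewrite /A /= /alphaD_fun betaK.
Qed.

(** Both sides are alternating in [u]. On families from g they agree by hypothesis; on families
    ending in [symD] they are the two sides of condition (i) times the same sign, which is
    invertible. *)
Lemma alphaD_morphP :
    (forall x, alpha (br x) = br (fmapf alpha x)) ->
  (forall u, A (B u) = B (fmapf A u)) <->
  (forall x, alpha (D x) = D (fmapf alpha x)).
Proof.
move=> br_morph; have AE x : A (in_ext x) = in_ext (alpha x) by [].
have BD x : A (B (frcons (m := m.+1) (fmapf (@in_ext K g) x) (symD g))) =
    in_ext ((-1) ^+ m *: alpha (D x)).
  by rewrite brD_rcons_symD AE linearZ.
have BA x : B (fmapf A (frcons (m := m.+1) (fmapf (@in_ext K g) x) (symD g))) =
    in_ext ((-1) ^+ m *: D (fmapf alpha x)).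
  by rewrite fmapf_frcons alphaD_in_ext alphaD_symD brD_rcons_symD.
split=> [morph x|Dx u].
  have /in_ext_inj/(scalerI _) := etrans (esym (BD x)) (etrans (morph _) (BA x)).
  by apply; rewrite signr_eq0.
have idE (u' : {ffun 'I_m.+1 -> extD g}) : fmapf idfun u' = u'.
  by apply/ffunP => j; rewrite ffunE.
pose F : altmap m.+1 (extD g) (extD g) := altmap_comp A idfun B.
pose G : altmap m.+1 (extD g) (extD g) := altmap_comp idfun A B.
have FE v : F v = A (B v) := congr1 (A \o B) (idE v).
have GE v : G v = B (fmapf A v) by [].
rewrite -FE -GE; apply: altmap_extD_eq => x; rewrite FE GE.
  by rewrite alphaD_in_ext !brD_in_ext AE br_morph.
by rewrite BD BA Dx.
Qed.

End Bracket.

(** * The Hom-Jacobi identity on g + K D *)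

Section Jacobi.
Variables (K : fieldType) (m : nat) (g : lmodType K).

(** The arity n is written [m.+2], so that n-1 and n-2 become [m.+1] and [m]. *)
Definition Hom_Jacobi (U : lmodType K) (b : altmap m.+2 U U) (a : {linear U -> U})
    (x : {ffun 'I_m.+1 -> U}) (y : {ffun 'I_m.+2 -> U}) : Prop :=
  b (frcons (m := m.+2) (fmapf a x) (b y)) =
  \sum_i b (fupd (fmapf a y) i (b (frcons (m := m.+2) x (y i)))).

(** The adjoint operator of [x], named so that it can carry a linear structure. *)
Definition bracket_last (U : lmodType K) (b : altmap m.+2 U U) x (v : U) : U :=
  b (frcons (m := m.+2) x v).

HB.instance Definition _ (U : lmodType K) (b : altmap m.+2 U U) x :=
  GRing.isLinear.Build K U U *:%R (bracket_last b x) (altmap_rcons_linear b x).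

Local Notation inE := (@in_ext K g).
Local Notation rcD x := (frcons (fmapf (@in_ext K g) x) (symD g)).

Lemma Hom_Jacobi_extP (b : altmap m.+2 (extD g) (extD g)) a :
    (forall x y, Hom_Jacobi b a (fmapf inE x) (fmapf inE y)) ->
    (forall x y, Hom_Jacobi b a (fmapf inE x) (rcD y)) ->
    (forall x y, Hom_Jacobi b a (rcD x) (fmapf inE y)) ->
    (forall x y, Hom_Jacobi b a (rcD x) (rcD y)) ->
  forall u v, Hom_Jacobi b a u v.
Proof.
move=> J00 J01 J10 J11 u v.
have extend_y u' : (forall y, Hom_Jacobi b a u' (fmapf inE y)) ->
    (forall y, Hom_Jacobi b a u' (rcD y)) -> forall v', Hom_Jacobi b a u' v'.
  have idE (v' : {ffun 'I_m.+2 -> extD g}) : fmapf idfun v' = v'.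
    by apply/ffunP => j; rewrite ffunE.
  move=> J0 J1 v'.
  (* The two sides as alternating maps of y, with x fixed. *)
  pose F : altmap m.+2 (extD g) (extD g) :=
    altmap_comp (bracket_last b (fmapf a u')) idfun b.
  pose G : altmap m.+2 (extD g) (extD g) := altmap_der b a (bracket_last b u').
  suff : F v' = G v' by rewrite /= idE.
  by apply: altmap_extD_eq => y; rewrite /= idE; [apply: J0 | apply: J1].
(* The two sides as alternating maps of x, with y fixed and arbitrary; the reduction in y follows
   for each special x. *)
pose F : altmap m.+1 (extD g) (extD g) :=
  altmap_comp idfun a (altmap_contract b (b v)).
pose G : altmap m.+1 (extD g) (extD g) :=
  altmap_sum (fun i => altmap_comp (altmap_arg b (fmapf a v) i) idfun
                                   (altmap_contract b (v i))).
have GE u' : G u' =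
    \sum_i b (fupd (fmapf a v) i (b (frcons (m := m.+2) u' (v i)))).
  apply: eq_bigr => i _ /=; congr (b (fupd _ _ (b (frcons _ _)))).
  by apply/ffunP => j; rewrite ffunE.
rewrite /Hom_Jacobi -GE.
apply: (altmap_extD_eq (F := F)) => x; rewrite GE; apply: extend_y => y.
- exact: J00.
- exact: J01.
- exact: J10.
- exact: J11.
Qed.

Variables (br : altmap m.+2 g g) (D : altmap m.+1 g g) (alpha : {linear g -> g}).
Let B := brD (n := m.+2) br D.
Let A := alphaD alpha.
Let s : K := (-1) ^+ m.+1.

Let s_inj : injective (fun x : g => s *: x).
Proof. by apply: scalerI; rewrite signr_eq0. Qed.

Let B_in_ext x v :
  B (frcons (m := m.+2) (fmapf inE x) (in_ext v)) =
  in_ext (br (frcons (m := m.+2) x v)).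
Proof. by rewrite -fmapf_frcons brD_in_ext. Qed.

Let B_symD x v :
  B (frcons (m := m.+2) (frcons (m := m.+1) (fmapf inE x) (symD g)) (in_ext v)) =
  - in_ext (s *: D (frcons (m := m.+1) x v)).
Proof. by rewrite altmap_rcons2_swap -fmapf_frcons brD_rcons_symD. Qed.

Lemma Hom_Jacobi_in_ext x y :
  Hom_Jacobi B A (fmapf inE x) (fmapf inE y) <-> Hom_Jacobi br alpha x y.
Proof.
rewrite /Hom_Jacobi !alphaD_in_ext brD_in_ext B_in_ext.
rewrite [X in _ = X](_ : _ = in_ext (\sum_i br
    (fupd (fmapf alpha y) i (br (frcons (m := m.+2) x (y i)))))); last first.
  rewrite linear_sum; apply: eq_bigr => i _.
  by rewrite ffunE B_in_ext -fmapf_fupd brD_in_ext.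
by split=> [/in_ext_inj|->].
Qed.

(** Every term carries the sign [s]. The summand acting on the final [symD] puts [D x] in its place
    and gives a bracket in g; moved to the left, it is the subtracted term of (ii). *)
Lemma Hom_Jacobi_symD_right x y :
  Hom_Jacobi B A (fmapf inE x) (rcD y) <->
  br (frcons (m := m.+2) (fmapf alpha x) (D y)) -
    br (frcons (m := m.+2) (fmapf alpha y) (D x)) =
  \sum_i D (fupd (fmapf alpha y) i (br (frcons (m := m.+2) x (y i)))).
Proof.
rewrite /Hom_Jacobi fmapf_frcons !alphaD_in_ext alphaD_symD brD_rcons_symD.
rewrite B_in_ext altmap_rcons_scale sum_ord_max.
rewrite fupd_frcons_max frcons_max brD_rcons_symD B_in_ext altmap_rcons_scale.
rewrite (eq_bigr (fun i => in_ext (s *: D (fupd (fmapf alpha y) i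
    (br (frcons (m := m.+2) x (y i))))))) => [|i _]; last first.
  rewrite frcons_lift ffunE B_in_ext fupd_frcons_lift -fmapf_fupd.
  by rewrite brD_rcons_symD.
rewrite -linear_sum -linearD -scaler_sumr -scalerDr.
split=> [/in_ext_inj/s_inj ->|<-]; first by rewrite addrC addKr.
by rewrite addrC subrK.
Qed.

(** In each bracket with x, [symD] stands in the last but one place; moving it to the end gives
    every term the common factor [- s]. *)
Lemma Hom_Jacobi_symD_left x y :
  Hom_Jacobi B A (rcD x) (fmapf inE y) <->
  D (frcons (m := m.+1) (fmapf alpha x) (br y)) =
  \sum_i br (fupd (fmapf alpha y) i (D (frcons (m := m.+1) x (y i)))).
Proof.
rewrite /Hom_Jacobi fmapf_frcons !alphaD_in_ext alphaD_symD brD_in_ext.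
rewrite B_symD.
rewrite (eq_bigr (fun i => - in_ext (s *: br (fupd (fmapf alpha y) i
    (D (frcons (m := m.+1) x (y i))))))) => [|i _]; last first.
  rewrite ffunE B_symD -linearN -fmapf_fupd brD_in_ext.
  by rewrite -scaleNr altmap_scale scaleNr linearN.
rewrite sumrN -linear_sum -scaler_sumr.
by split=> [/oppr_inj/in_ext_inj/s_inj|->].
Qed.

(** The symbol is moved to the end in the brackets with x and already stands there in those with y,
    whence the common factor [- s * s]. *)
Lemma Hom_Jacobi_symD_both x y :
  Hom_Jacobi B A (rcD x) (rcD y) <->
  D (frcons (m := m.+1) (fmapf alpha x) (D y)) =
  \sum_i D (fupd (fmapf alpha y) i (D (frcons (m := m.+1) x (y i)))).
Proof.
rewrite /Hom_Jacobi !fmapf_frcons !alphaD_in_ext alphaD_symD brD_rcons_symD.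
rewrite B_symD altmap_rcons_scale sum_ord_max.
rewrite frcons_max fupd_frcons_max.
(* The summand acting on the final [symD] contains a bracket with [symD] twice, so it vanishes. *)
rewrite [B (frcons (m := m.+2) (rcD x) (symD g))](_ : _ = 0); last first.
  rewrite (@altmap_alt _ _ _ _ B _ (lift ord_max ord_max) ord_max) //.
    by rewrite eq_sym neq_lift.
  by rewrite frcons_lift !frcons_max.
rewrite altmap_rcons0 add0r.
rewrite (eq_bigr (fun i => - in_ext (s *: (s *: D (fupd (fmapf alpha y) i
    (D (frcons (m := m.+1) x (y i)))))))) => [|i _]; last first.
  rewrite frcons_lift ffunE B_symD -linearN fupd_frcons_lift -fmapf_fupd.
  by rewrite brD_rcons_symD -scaleNr altmap_scale !scaleNr scalerN linearN.
rewrite sumrN -linear_sum -!scaler_sumr.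
by split=> [/oppr_inj/in_ext_inj/s_inj/s_inj|->].
Qed.

End Jacobi.

Theorem theorem5p4 (K : closedFieldType) (charK : [pchar K] =i pred0)
    (n : nat) (hn : (2 <= n)%N) (g : lmodType K)
    (br : altmap n g g) (alpha : {linear g -> g})
    (hg : is_n_Hom_Lie br alpha) (D : altmap n.-1 g g) :
  is_n_Hom_Lie (brD br D) (alphaD alpha) <-> generalized_derivation br alpha D.
Proof.
case: n hn br hg D => [|[|m]] // _ br [br_bij br_morph br_jac] D.
split=> [[_ morph jac]|[Dcomm Dbr Dbr' DD]].
  split=> [|x y|x y|x y].
  - exact/(alphaD_morphP D br_morph).
  - exact/(Hom_Jacobi_symD_right br D).
  - exact/(Hom_Jacobi_symD_left br D).
  - exact/(Hom_Jacobi_symD_both br D).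
split; first exact: alphaD_bij.
  exact/(alphaD_morphP D br_morph).
(* The four cases are, in order, the identity [br_jac] of g and conditions (ii), (iii) and (iv). *)
apply: Hom_Jacobi_extP => x y.
- exact/Hom_Jacobi_in_ext.
- exact/Hom_Jacobi_symD_right.
- exact/Hom_Jacobi_symD_left.
- exact/Hom_Jacobi_symD_both.
Qed.
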